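(* Let $\mathbf{z}^\ast$ be the unique invariant fluid model solution. Then every fluid model solution $\mathbf{z}(\cdot)$ satisfies $\mathbf{z}(t)\to\mathbf{z}^\ast$ as $t\to\infty$.
   Context: Notation: $\mathbb{R}_+=[0,\infty)$, $\|\mathbf{x}\|_1=\sum_{i=1}^I |x_i|$ for $\mathbf{x}\in\mathbb{R}^I$. Parameters: an integer $I\ge 1$ and positive reals $\lambda,\mu_1,\dots,\mu_I,\nu$. Standing assumption (overload): $\lambda\sum_{i=1}^I 1/\mu_i>1$. Fluid model solution (FMS): a continuous function $\mathbf{z}=(z_1,\dots,z_I)\colon\mathbb{R}_+\to\mathbb{R}_+^I$ with $\inf_{t\ge\delta}\|\mathbf{z}(t)\|_1>0$ for every $\delta>0$ that satisfies, for all $t>0$, $$z_1'(t)=\lambda-\mu_1\frac{z_1(t)}{\|\mathbf{z}(t)\|_1}-\nu z_1(t),$$ $$z_i'(t)=\mu_{i-1}\frac{z_{i-1}(t)}{\|\mathbf{z}(t)\|_1}-\mu_i\frac{z_i(t)}{\|\mathbf{z}(t)\|_1}-\nu z_i(t),\quad 2\le i\le I.$$ An FMS is invariant if it is constant in time. There exists exactly one invariant FMS; it is identified with its constant value $\mathbf{z}^\ast\in\mathbb{R}_+^I$. *)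

(* Defs.v *)
From HB Require Import structures.
From mathcomp Require Import all_boot all_order all_algebra.
From mathcomp Require Import all_classical all_reals all_analysis.

Set Implicit Arguments.
Unset Strict Implicit.
Unset Printing Implicit Defensive.

Import Order.TTheory GRing.Theory Num.Theory.
Import numFieldNormedType.Exports.

Local Open Scope classical_set_scope.
Local Open Scope ring_scope.

(* The norm that the library puts on row vectors is the sup norm. *)
Definition norm1 (R : realType) (N : nat) (x : 'rV[R]_N) : R :=
  \sum_(i < N) `|x 0 i|.

(* Indices are shifted to 0, ..., N - 1.  Functions on [0, +oo[ are represented
   by total functions on R, and every clause only concerns their values (or
   germs) on [0, +oo[.  The equation of rank i >= 2 is indexed by
   the pair (i, j) of consecutive ordinals with j the successor of i. *)
Record fluid_model_solution (R : realType) (N : nat) (lambda nu : R)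
    (mu : 'I_N -> R) (z : R -> 'rV[R]_N) : Prop := FluidModelSolution {
  fms_continuous : {within `[0, +oo[, continuous z};
  fms_ge0 : forall (t : R) (i : 'I_N), 0 <= t -> 0 <= z t 0 i;
  fms_inf_gt0 : forall delta : R, 0 < delta ->
    0 < inf [set norm1 (z t) | t in `[delta, +oo[];
  fms_first : forall (t : R) (i : 'I_N), 0 < t -> i = 0%N :> nat ->
    is_derive t 1 (fun s => z s 0 i)
      (lambda - mu i * (z t 0 i / norm1 (z t)) - nu * z t 0 i);
  fms_next : forall (t : R) (i j : 'I_N), 0 < t -> j = i.+1 :> nat ->
    is_derive t 1 (fun s => z s 0 j)
      (mu i * (z t 0 i / norm1 (z t)) - mu j * (z t 0 j / norm1 (z t))
       - nu * z t 0 j)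
}.

Definition invariant_fms (R : realType) (N : nat) (lambda nu : R)
    (mu : 'I_N -> R) (zs : 'rV[R]_N) : Prop :=
  fluid_model_solution lambda nu mu (fun=> zs).

(* Main.v *)
Require Import Defs.
From HB Require Import structures.
From mathcomp Require Import all_boot all_order all_algebra.
From mathcomp Require Import all_classical all_reals all_analysis.
From mathcomp Require Import ring lra.

Set Implicit Arguments.
Unset Strict Implicit.
Unset Printing Implicit Defensive.

Import Order.TTheory GRing.Theory Num.Theory.
Import numFieldNormedType.Exports.

Local Open Scope classical_set_scope.
Local Open Scope ring_scope.

(** The total mass [s = norm1 z] enters the equations only through the service
    rate [1 / s], and all the partial sums [S_k] of the first [k] coordinates
    respond monotonically to it.  Telescoping the equations gives
      S_(k+1)' = lambda - m_k (S_(k+1) - S_k) / s - nu S_(k+1),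
    and [S_(k+1) - S_k >= 0].  Hence, if [s <= c] eventually, replacing [s] by
    [c] turns this into a linear differential inequality, and comparison yields
      limsup S_(k+1) <= (lambda c + m_k limsup S_k) / (m_k + nu c);
    by induction [limsup S_k <= c * rho_k(c)] for the rational functions
      rho_0 = 0,   rho_(k+1)(c) = (lambda + m_k rho_k(c)) / (m_k + nu c)
    ([ratio] below; the induction is [flow_limsup]).  The bound [c <= s] gives
    the reverse inequality for the liminf ([flow_liminf]).

    Let [N] be the number of coordinates, so that [s = S_N].  The same
    computation with equalities shows that the total mass [x] of an invariant
    solution satisfies [rho_N(x) = 1] and that its partial sums are
    [x * rho_k(x)] ([stationary_flow_ratio]).  Let [M] be the limsup of [s].
    Using the bounds [c > M] close to [M], one gets [M <= M * rho_N(M)], so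
    [rho_N(M) >= 1 = rho_N(x)], and [M <= x] because [rho_N] is strictly
    decreasing ([flow_total_le]); symmetrically the liminf of [s], which is
    positive, is at least [x] ([flow_total_ge]).  So [s] tends to [x]; feeding
    this back into the two inductions makes every [S_k] converge to
    [x * rho_k(x)] ([flow_cvg]), and each coordinate is a difference of two
    consecutive partial sums. *)

(** * Scalar comparison *)

(** Real-valued limsup and liminf bounds, stated without extended reals so that
    boundedness of [f] need not be known beforehand. *)
Definition limsup_le (R : realType) (f : R -> R) (c : R) : Prop :=
  forall e : R, 0 < e -> \forall t \near +oo, f t <= c + e.

Definition liminf_ge (R : realType) (f : R -> R) (c : R) : Prop :=
  forall e : R, 0 < e -> \forall t \near +oo, c - e <= f t.

(** Multiplying [f - b / a] by the integrating factor [exp (a t)] gives an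
    eventually nonincreasing function, so [f - b / a <= C exp (- a t)]. *)
Lemma relaxation_limsup (R : realType) (f df : R -> R) (a b : R) :
  0 < a -> (forall t : R, 0 < t -> is_derive t 1 f (df t)) ->
  (\forall t \near +oo, df t <= b - a * f t) -> limsup_le f (b / a).
Proof.
move=> a_gt0 fdf [M [_ dfM]] e e_gt0.
pose T := Num.max M 0 + 1.
have MT : M < T by rewrite /T ltr_pwDr// le_max lexx.
have T_gt0 : 0 < T by rewrite /T ltr_pwDr// le_max lexx orbT.
pose g t := (f t - b / a) * expR (a * t).
pose dg t := (df t - (b - a * f t)) * expR (a * t).
have gdg (t : R) : 0 < t -> is_derive t 1 g (dg t).
  move=> t_gt0; have ? := fdf t t_gt0.
  have ? : is_derive t 1 (fun u => expR (a * u)) (a * expR (a * t)).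
    have ? := is_derive_expR (a * t).
    apply: is_derive_eq.
    by rewrite /GRing.scale/=; ring.
  rewrite /g; apply: is_derive_eq.
  rewrite /GRing.scale/= /dg; field; lra.
have g_le t : T <= t -> g t <= `|g T|.
  move=> Tt; apply: le_trans (ler_norm _).
  apply: (@ler0_derive1_nincry _ g T) => //.
  - move=> x; rewrite in_itv/= andbT => Tx.
    by have [] := gdg x (lt_trans T_gt0 Tx).
  - move=> x; rewrite in_itv/= andbT => Tx.
    have [_] := gdg x (lt_trans T_gt0 Tx); rewrite derive1E => ->.
    rewrite /dg mulr_le0_ge0 ?expR_ge0// subr_le0.
    by apply: dfM; exact: lt_trans Tx.
  - apply: derivable_within_continuous => x; rewrite in_itv/= andbT => Tx.
    by have [] := gdg x (lt_le_trans T_gt0 Tx).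
near=> t.
have Tt : T <= t by near: t; apply: nbhs_pinfty_ge; exact: num_real.
have Ct : `|g T| / (a * e) <= t.
  by near: t; apply: nbhs_pinfty_ge; exact: num_real.
have := g_le t Tt.
have := expR_ge1Dx (a * t).
rewrite ler_pdivrMr ?mulr_gt0// in Ct.
rewrite /g; set E := expR _; set C := `|_| in Ct * => E1 fE.
rewrite -lerBlDl -(@ler_pM2r _ E) ?expR_gt0//.
apply: (le_trans fE); apply: (le_trans Ct).
have -> : t * (a * e) = e * (a * t) by ring.
rewrite ler_pM2l//; lra.
Unshelve. all: by end_near. Qed.

Lemma relaxation_liminf (R : realType) (f df : R -> R) (a b : R) :
  0 < a -> (forall t : R, 0 < t -> is_derive t 1 f (df t)) ->
  (\forall t \near +oo, b - a * f t <= df t) -> liminf_ge f (b / a).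
Proof.
move=> a_gt0 fdf bdf e e_gt0.
have := @relaxation_limsup _ (fun t => - f t) (fun t => - df t) a (- b) a_gt0.
move=> /(_ _ _ e e_gt0) H; near=> t.
have : - f t <= - b / a + e.
  near: t; apply: H.
    by move=> t /fdf ?; apply: is_deriveN.
  by apply: filterS bdf => t; lra.
by rewrite mulNr; lra.
Unshelve. all: by end_near. Qed.

(** * The response of the partial sums to a frozen total mass *)

(** If the total mass in the service rates is frozen at [x], the resulting
    linear system has the equilibrium with partial sums
    [x * ratio lambda nu m x k].  Dividing by [x] is what makes the family
    decreasing in [x]: the equilibrium itself grows with [x], but less than
    linearly. *)
Fixpoint ratio (R : realType) (lambda nu : R) (m : nat -> R) (x : R) (k : nat)
    : R :=
  if k is k'.+1 then
    (lambda + m k' * ratio lambda nu m x k') / (m k' + nu * x)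
  else 0.

Lemma ratio_ge0 (R : realType) (lambda nu : R) (m : nat -> R) (x : R) k :
  0 < lambda -> 0 < nu -> (forall i, 0 < m i) -> 0 < x ->
  0 <= ratio lambda nu m x k.
Proof.
move=> l0 n0 m0 x0; elim: k => //= k IH.
by rewrite divr_ge0// addr_ge0 ?mulr_ge0// ltW.
Qed.

Lemma ratio_gt0 (R : realType) (lambda nu : R) (m : nat -> R) (x : R) k :
  0 < lambda -> 0 < nu -> (forall i, 0 < m i) -> 0 < x ->
  0 < ratio lambda nu m x k.+1.
Proof.
move=> l0 n0 m0 x0 /=.
rewrite divr_gt0//; last by rewrite addr_gt0 ?mulr_gt0.
by rewrite ltr_wpDr// mulr_ge0 ?ratio_ge0// ltW.
Qed.

Lemma ratio_anti (R : realType) (lambda nu : R) (m : nat -> R) (x y : R) k :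
  0 < lambda -> 0 < nu -> (forall i, 0 < m i) -> 0 < x -> x <= y ->
  ratio lambda nu m y k <= ratio lambda nu m x k.
Proof.
move=> l0 n0 m0 x0 xy; have y0 := lt_le_trans x0 xy.
elim: k => //= k IH.
apply: ler_pM.
- by rewrite addr_ge0 ?mulr_ge0 ?ratio_ge0// ltW.
- by rewrite invr_ge0 addr_ge0 ?mulr_ge0// ltW.
- by rewrite lerD2l ler_pM2l.
- by rewrite lef_pV2 ?posrE ?addr_gt0 ?mulr_gt0// lerD2l ler_pM2l.
Qed.

Lemma ratio_anti_lt (R : realType) (lambda nu : R) (m : nat -> R) (x y : R) k :
  0 < lambda -> 0 < nu -> (forall i, 0 < m i) -> 0 < x -> x < y ->
  ratio lambda nu m y k.+1 < ratio lambda nu m x k.+1.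
Proof.
move=> l0 n0 m0 x0 xy /=; have y0 := lt_trans x0 xy.
have num_gt0 : 0 < lambda + m k * ratio lambda nu m x k.
  by rewrite ltr_wpDr// mulr_ge0 ?ratio_ge0// ltW.
apply: (@le_lt_trans _ _
  ((lambda + m k * ratio lambda nu m x k) / (m k + nu * y))).
  rewrite ler_pM2r ?invr_gt0 ?addr_gt0 ?mulr_gt0//.
  by rewrite lerD2l ler_pM2l// ratio_anti// ltW.
rewrite ltr_pM2l// ltf_pV2 ?posrE ?addr_gt0 ?mulr_gt0//.
by rewrite ltrD2l ltr_pM2l.
Qed.

(** * Asymptotic bounds for the partial sums *)

(** The cumulative masses [S k = z_1 + ... + z_k] of a fluid model solution,
    including the empty sum and indexed by natural numbers, which suits
    induction along the stages better than ordinals do. *)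
Record cumulative_flow (R : realType) (lambda nu : R) (m : nat -> R) (N : nat)
    (S : nat -> R -> R) : Prop := CumulativeFlow {
  flow0 : forall t, S 0%N t = 0;
  flow_step : forall k (t : R), (k < N)%N -> 0 < t -> is_derive t 1 (S k.+1)
    (lambda - m k * ((S k.+1 t - S k t) / S N t) - nu * S k.+1 t);
  flow_mono : forall k t, (k < N)%N -> 0 < t -> S k t <= S k.+1 t;
  flow_away : exists2 d, 0 < d & \forall t \near +oo, d <= S N t
}.

(** Since [S k.+1 - S k] is nonnegative, an upper bound on the total mass
    bounds the drift of [S k.+1] from above by a linear expression in [S k.+1]
    whose constant term is controlled by the induction hypothesis on [S k]. *)
Lemma flow_limsup (R : realType) (lambda nu : R) (m : nat -> R) (N : nat)
    (S : nat -> R -> R) (c : R) :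
  0 < nu -> (forall i, 0 < m i) -> cumulative_flow lambda nu m N S ->
  0 < c -> (\forall t \near +oo, S N t <= c) ->
  forall k, (k <= N)%N -> limsup_le (S k) (c * ratio lambda nu m c k).
Proof.
move=> n0 m0 [S0 dS monoS [d d0 Sd]] c0 Sc.
elim=> [_ e e0|k IH kN e e0].
  by apply: nearW => t; rewrite S0 mulr0 add0r ltW.
have e2 : 0 < e / 2 by rewrite divr_gt0.
pose a := m k / c + nu.
have a0 : 0 < a by rewrite /a addr_gt0 ?divr_gt0.
pose b := lambda + m k / c * (c * ratio lambda nu m c k + e / 2).
have := @relaxation_limsup _ _ _ a b a0 (fun t => dS k t kN) => /(_ _ _ e2) H.
near=> t.
have : S k.+1 t <= b / a + e / 2.
  near: t; apply: H; near=> t.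
  have t0 : 0 < t by near: t; apply: nbhs_pinfty_gt; exact: num_real.
  have Skt : S k t <= c * ratio lambda nu m c k + e / 2.
    by near: t; exact: IH (ltnW kN) _ e2.
  have Sdt : d <= S N t by near: t.
  have Sct : S N t <= c by near: t.
  have zS : (S k.+1 t - S k t) / c <= (S k.+1 t - S k t) / S N t.
    rewrite ler_wpM2l ?subr_ge0 ?monoS//.
    by rewrite lef_pV2 ?posrE// (lt_le_trans d0).
  have := ler_wpM2l (ltW (m0 k)) zS.
  have := ler_wpM2l (ltW (divr_gt0 (m0 k) c0)) Skt.
  rewrite /b /a.
  have -> : m k * ((S k.+1 t - S k t) / c)
      = m k / c * S k.+1 t - m k / c * S k t.
    by ring.
  lra.
(* The tolerance [e / 2] on [S k] reaches [S k.+1] multiplied by a factor at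
   most one, which leaves [e / 2] for the comparison lemma. *)
move=> /le_trans; apply.
have mnc : 0 < m k + nu * c by rewrite addr_gt0 ?mulr_gt0.
have -> : b / a = c * ratio lambda nu m c k.+1 + m k / (m k + nu * c) * (e / 2).
  by rewrite /b /a /=; field; rewrite !gt_eqF// ?addr_gt0 ?divr_gt0.
have : m k / (m k + nu * c) <= 1.
  by rewrite ler_pdivrMr// mul1r lerDl ltW ?mulr_gt0.
move=> /(ler_wpM2r (ltW e2)); lra.
Unshelve. all: by end_near. Qed.

Lemma flow_liminf (R : realType) (lambda nu : R) (m : nat -> R) (N : nat)
    (S : nat -> R -> R) (c : R) :
  0 < nu -> (forall i, 0 < m i) -> cumulative_flow lambda nu m N S ->
  0 < c -> (\forall t \near +oo, c <= S N t) ->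
  forall k, (k <= N)%N -> liminf_ge (S k) (c * ratio lambda nu m c k).
Proof.
move=> n0 m0 [S0 dS monoS _] c0 Sc.
elim=> [_ e e0|k IH kN e e0].
  by apply: nearW => t; rewrite S0 mulr0 sub0r oppr_le0 ltW.
have e2 : 0 < e / 2 by rewrite divr_gt0.
pose a := m k / c + nu.
have a0 : 0 < a by rewrite /a addr_gt0 ?divr_gt0.
pose b := lambda + m k / c * (c * ratio lambda nu m c k - e / 2).
have := @relaxation_liminf _ _ _ a b a0 (fun t => dS k t kN) => /(_ _ _ e2) H.
near=> t.
have : b / a - e / 2 <= S k.+1 t.
  near: t; apply: H; near=> t.
  have t0 : 0 < t by near: t; apply: nbhs_pinfty_gt; exact: num_real.
  have Skt : c * ratio lambda nu m c k - e / 2 <= S k t.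
    by near: t; exact: IH (ltnW kN) _ e2.
  have Sct : c <= S N t by near: t.
  have zS : (S k.+1 t - S k t) / S N t <= (S k.+1 t - S k t) / c.
    rewrite ler_wpM2l ?subr_ge0 ?monoS//.
    by rewrite lef_pV2 ?posrE// (lt_le_trans c0).
  have := ler_wpM2l (ltW (m0 k)) zS.
  have := ler_wpM2l (ltW (divr_gt0 (m0 k) c0)) Skt.
  rewrite /b /a.
  have -> : m k * ((S k.+1 t - S k t) / c)
      = m k / c * S k.+1 t - m k / c * S k t.
    by ring.
  lra.
apply: le_trans.
have mnc : 0 < m k + nu * c by rewrite addr_gt0 ?mulr_gt0.
have -> : b / a = c * ratio lambda nu m c k.+1 - m k / (m k + nu * c) * (e / 2).
  by rewrite /b /a /=; field; rewrite !gt_eqF// ?addr_gt0 ?divr_gt0.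
have : m k / (m k + nu * c) <= 1.
  by rewrite ler_pdivrMr// mul1r lerDl ltW ?mulr_gt0.
move=> /(ler_wpM2r (ltW e2)); lra.
Unshelve. all: by end_near. Qed.

(** Discarding the service term leaves [s' <= lambda - nu s]. *)
Lemma flow_bounded (R : realType) (lambda nu : R) (m : nat -> R) (n : nat)
    (S : nat -> R -> R) :
  0 < nu -> (forall i, 0 < m i) -> cumulative_flow lambda nu m n.+1 S ->
  \forall t \near +oo, S n.+1 t <= lambda / nu + 1.
Proof.
move=> n0 m0 [S0 dS monoS [d d0 Sd]].
apply: (relaxation_limsup n0 (fun t => dS n t (ltnSn n))) => //.
near=> t.
rewrite lerD2r gerBl mulr_ge0 ?(ltW (m0 _))// divr_ge0//.
  rewrite subr_ge0 monoS//; near: t; apply: nbhs_pinfty_gt; exact: num_real.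
by apply: le_trans (ltW d0) _; near: t.
Unshelve. all: by end_near. Qed.

(** Let [M] be the infimum of the eventual upper bounds [b] of the total mass,
    that is, its limsup.  If [M > x], then [r = ratio M < ratio x = 1], and
    every such [b] between [M] and [M / r] has [b * ratio b <= b * r < M], so
    [flow_limsup] turns it into an eventual bound below [M]. *)
Lemma flow_total_le (R : realType) (lambda nu : R) (m : nat -> R) (n : nat)
    (S : nat -> R -> R) (x : R) :
  0 < lambda -> 0 < nu -> (forall i, 0 < m i) ->
  cumulative_flow lambda nu m n.+1 S ->
  0 < x -> ratio lambda nu m x n.+1 = 1 ->
  forall c, x < c -> \forall t \near +oo, S n.+1 t <= c.
Proof.
move=> l0 n0 m0 flowS x0 rx1 c xc.
pose A := [set b | \forall t \near +oo, S n.+1 t <= b].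
have A0 : A !=set0 by exists (lambda / nu + 1); exact: flow_bounded flowS.
have [d d0 Sd] := flow_away flowS.
have dA b : A b -> d <= b.
  move=> Ab; near (+oo : set_system R) => t.
  by apply: (@le_trans _ _ (S n.+1 t)); near: t.
have hA : has_inf A by split=> //; exists d.
have Mx : inf A <= x.
  rewrite leNgt; apply/negP => xM.
  set M := inf A in xM.
  have M0 : 0 < M by exact: lt_trans xM.
  have := ratio_anti_lt n l0 n0 m0 x0 xM; rewrite rx1.
  have := ratio_gt0 n l0 n0 m0 M0.
  set r := ratio _ _ _ M _ => r0 r1.
  have [b Ab bMr] : exists2 b, A b & b < M / r.
    by apply: inf_lt => //; rewrite ltr_pdivlMr// gtr_pMr.
  have Mb : M <= b by apply: ge_inf => //; case: hA.
  have b0 := lt_le_trans M0 Mb.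
  rewrite ltr_pdivlMr// in bMr.
  have e0 : 0 < (M - b * r) / 2 by lra.
  have rb := ler_wpM2l (ltW b0) (ratio_anti n.+1 l0 n0 m0 M0 Mb).
  have : A (b * r + (M - b * r) / 2).
    apply: filterS (flow_limsup n0 m0 flowS b0 Ab (leqnn _) e0) => t.
    move=> /le_trans; apply.
    by rewrite lerD2r.
  by move=> /(ge_inf hA.2); rewrite -/M; lra.
have [b Ab bc] : exists2 b, A b & b < c.
  by apply: inf_lt => //; exact: le_lt_trans xc.
by apply: filterS Ab => t /le_trans; apply; exact: ltW.
Unshelve. all: by end_near. Qed.

(** The mirror image of [flow_total_le].  That the total mass stays away from
    zero matters here: it makes the liminf positive, hence comparable with [x]
    through [ratio], which is only controlled on positive arguments. *)
Lemma flow_total_ge (R : realType) (lambda nu : R) (m : nat -> R) (n : nat)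
    (S : nat -> R -> R) (x : R) :
  0 < lambda -> 0 < nu -> (forall i, 0 < m i) ->
  cumulative_flow lambda nu m n.+1 S ->
  0 < x -> ratio lambda nu m x n.+1 = 1 ->
  forall c, c < x -> \forall t \near +oo, c <= S n.+1 t.
Proof.
move=> l0 n0 m0 flowS x0 rx1 c cx.
pose A := [set b | \forall t \near +oo, b <= S n.+1 t].
have [d d0 Ad] := flow_away flowS.
have A0 : A !=set0 by exists d.
have hA : has_sup A.
  split=> //; exists (lambda / nu + 1) => b Ab.
  have bd := flow_bounded n0 m0 flowS.
  near (+oo : set_system R) => t.
  by apply: (@le_trans _ _ (S n.+1 t)); near: t.
have xM : x <= sup A.
  rewrite leNgt; apply/negP => Mx.
  set M := sup A in Mx.
  have M0 : 0 < M by apply: lt_le_trans d0 _; apply: ub_le_sup => //; case: hA.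
  have := ratio_anti_lt n l0 n0 m0 M0 Mx; rewrite rx1.
  set r := ratio _ _ _ M _ => r1.
  have r0 : 0 < r by lra.
  have [b Ab bMr] : exists2 b, A b & M / r < b.
    by apply: sup_gt => //; rewrite ltr_pdivrMr// ltr_pMr.
  have bM : b <= M by apply: ub_le_sup => //; case: hA.
  have b0 : 0 < b by apply: lt_trans bMr; rewrite divr_gt0.
  rewrite ltr_pdivrMr// in bMr.
  have e0 : 0 < (b * r - M) / 2 by lra.
  have rb := ler_wpM2l (ltW b0) (ratio_anti n.+1 l0 n0 m0 b0 bM).
  have : A (b * r - (b * r - M) / 2).
    apply: filterS (flow_liminf n0 m0 flowS b0 Ab (leqnn _) e0) => t.
    by apply: le_trans; rewrite lerD2r.
  by move=> /(ub_le_sup hA.2); rewrite -/M; lra.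
have [b Ab bc] : exists2 b, A b & c < b.
  by apply: sup_gt => //; exact: lt_le_trans xM.
by apply: filterS Ab => t; apply: le_trans; exact: ltW.
Unshelve. all: by end_near. Qed.

(** The total mass is eventually within [h] of [x], and monotonicity
    of [ratio] alone gives [(x + h) * ratio (x + h) k <= (x + h) * ratio x k]
    and the opposite inequality at [x - h]; so the bounds on [S k] overshoot
    [x * ratio x k] by at most [h * ratio x k]. *)
Lemma flow_cvg (R : realType) (lambda nu : R) (m : nat -> R) (n : nat)
    (S : nat -> R -> R) (x : R) :
  0 < lambda -> 0 < nu -> (forall i, 0 < m i) ->
  cumulative_flow lambda nu m n.+1 S ->
  0 < x -> ratio lambda nu m x n.+1 = 1 ->
  forall k, (k <= n.+1)%N -> S k t @[t --> +oo] --> x * ratio lambda nu m x k.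
Proof.
move=> l0 n0 m0 flowS x0 rx1 k kn.
apply/cvgrPdist_le => e e0.
have e2 : 0 < e / 2 by lra.
set r := ratio _ _ _ _ _.
have r0 : 0 <= r by exact: ratio_ge0.
(* [h] keeps [x - h] positive and makes [h * r] at most [e / 2]; the
   increment [r + 1] avoids dividing by zero when [k = 0]. *)
pose h := Num.min (x / 2) (e / 2 / (r + 1)).
have h0 : 0 < h by rewrite /h lt_min !divr_gt0// ltr_wpDl.
have hx : h <= x / 2 by rewrite /h ge_min lexx.
have he : h * r <= e / 2.
  have : h <= e / 2 / (r + 1) by rewrite /h ge_min lexx orbT.
  rewrite ler_pdivlMr ?ltr_wpDl// mulrDr mulr1; lra.
have xh0 : 0 < x + h by lra.
have xh0' : 0 < x - h by lra.
have xh : x < x + h by lra.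
have xh' : x - h < x by lra.
have up := flow_limsup n0 m0 flowS xh0
  (flow_total_le l0 n0 m0 flowS x0 rx1 xh) kn e2.
have lo := flow_liminf n0 m0 flowS xh0'
  (flow_total_ge l0 n0 m0 flowS x0 rx1 xh') kn e2.
have := ler_wpM2l (ltW xh0) (ratio_anti k l0 n0 m0 x0 (ltW xh)).
have := ler_wpM2l (ltW xh0') (ratio_anti k l0 n0 m0 xh0' (ltW xh')).
rewrite -/r mulrDl mulrBl => r1 r2.
near=> t.
have upt : S k t <= (x + h) * ratio lambda nu m (x + h) k + e / 2.
  by near: t.
have lot : (x - h) * ratio lambda nu m (x - h) k - e / 2 <= S k t.
  by near: t.
rewrite ler_norml; lra.
Unshelve. all: by end_near. Qed.

(** * From fluid model solutions to cumulative flows *)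

Definition partial_sum (R : realType) (n : nat) (z : R -> 'rV[R]_n.+1) (k : nat)
    (t : R) : R :=
  \sum_(j < k) z t 0 (inord j).

Lemma norm1_partial_sum (R : realType) (n : nat) (z : R -> 'rV[R]_n.+1)
    (t : R) :
  (forall i, 0 <= z t 0 i) -> norm1 (z t) = partial_sum z n.+1 t.
Proof.
by move=> z0; apply: eq_bigr => i _; rewrite inord_val ger0_norm.
Qed.

Lemma fms_norm1_away (R : realType) (N : nat) (lambda nu : R) (mu : 'I_N -> R)
    (z : R -> 'rV[R]_N) :
  fluid_model_solution lambda nu mu z ->
  exists2 d, 0 < d & forall t, 1 <= t -> d <= norm1 (z t).
Proof.
move=> z_fms; eexists; first exact: (fms_inf_gt0 z_fms (@ltr01 R)).
move=> t t1; apply: ge_inf; last by exists t => //=; rewrite in_itv/= t1.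
by exists 0 => _ [u _ <-]; apply: sumr_ge0.
Qed.

(** The output of each stage is the input of the next one, so the service terms
    telescope and only that of the last stage is left. *)
Lemma fms_cumulative_flow (R : realType) (n : nat) (lambda nu : R)
    (mu : 'I_n.+1 -> R) (z : R -> 'rV[R]_n.+1) :
  fluid_model_solution lambda nu mu z ->
  cumulative_flow lambda nu (fun k => mu (inord k)) n.+1 (partial_sum z).
Proof.
move=> z_fms; have z0 := fms_ge0 z_fms.
have SS k t : partial_sum z k.+1 t = partial_sum z k t + z t 0 (inord k).
  by rewrite /partial_sum big_ord_recr.
have Sn t : 0 < t -> partial_sum z n.+1 t = norm1 (z t).
  by move=> t0; rewrite norm1_partial_sum// => i; rewrite z0 ?ltW.
split.
- by move=> t; rewrite /partial_sum big_ord0.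
- move=> k t + t0; rewrite Sn//.
  elim: k => [_|k IH kn].
    have -> : partial_sum z 1 = (fun s => z s 0 (inord 0)).
      by apply/funext => s; rewrite /partial_sum big_ord1.
    rewrite /partial_sum big_ord0 subr0.
    by apply: (fms_first z_fms) => //; rewrite inordK.
  have -> : partial_sum z k.+2
      = partial_sum z k.+1 \+ (fun s => z s 0 (inord k.+1)).
    by apply/funext => s; rewrite SS.
  have ? := IH (ltnW kn).
  have jk : (inord k.+1 : 'I_n.+1) = (inord k : 'I_n.+1).+1 :> nat.
    by rewrite !inordK// ltnW.
  have ? := fms_next z_fms t0 jk.
  apply: is_derive_eq.
  by rewrite /= (SS k); ring.
- by move=> k t _ t0; rewrite SS lerDl z0// ltW.
- have [d d0 zd] := fms_norm1_away z_fms; exists d => //.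
  near=> t; rewrite Sn; last by near: t; apply: nbhs_pinfty_gt; exact: num_real.
  by apply: zd; near: t; apply: nbhs_pinfty_ge; exact: num_real.
Unshelve. all: by end_near. Qed.

(** For a constant flow the drift vanishes, and solving for [S k.+1] in terms
    of [S k] is the recursion that defines [ratio]. *)
Lemma stationary_flow_ratio (R : realType) (lambda nu : R) (m : nat -> R)
    (N : nat) (S : nat -> R) :
  0 < nu -> (forall i, 0 < m i) ->
  cumulative_flow lambda nu m N (fun k=> fun=> S k) -> 0 < S N ->
  forall k, (k <= N)%N -> S k = S N * ratio lambda nu m (S N) k.
Proof.
move=> n0 m0 [S0 dS _ _] SN0.
elim=> [_|k IH kN]; first by rewrite (S0 0) mulr0.
have [_] := dS k 1 kN ltr01.
rewrite derive_cst => eq0.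
have mnc : 0 < m k + nu * S N by rewrite addr_gt0 ?mulr_gt0.
have Sk := IH (ltnW kN).
rewrite /=; set r := ratio _ _ _ _ _ in Sk *.
apply: (mulfI (lt0r_neq0 mnc)).
have -> : (m k + nu * S N) * (S N * ((lambda + m k * r) / (m k + nu * S N)))
   = S N * lambda + m k * (S N * r) by field; rewrite gt_eqF.
rewrite -Sk.
have -> : lambda = m k * ((S k.+1 - S k) / S N) + nu * S k.+1.
  by clear - eq0; lra.
by field; rewrite gt_eqF.
Qed.

(** * Convergence *)

Theorem theorem3 (R : realType) (N : nat) (lambda nu : R) (mu : 'I_N -> R)
    (N_ge1 : (1 <= N)%N)
    (lambda_gt0 : 0 < lambda) (mu_gt0 : forall i : 'I_N, 0 < mu i)
    (nu_gt0 : 0 < nu)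
    (overload : 1 < lambda * \sum_(i < N) (mu i)^-1)
    (zstar : 'rV[R]_N) (zstar_invariant : invariant_fms lambda nu mu zstar)
    (z : R -> 'rV[R]_N) (z_fms : fluid_model_solution lambda nu mu z) :
  z t @[t --> +oo] --> zstar.
Proof.
case: N => [//|n] in mu N_ge1 mu_gt0 overload zstar zstar_invariant z z_fms *.
pose m k := mu (inord k).
have m_gt0 k : 0 < m k by exact: mu_gt0.
pose Sstar k := partial_sum (fun=> zstar) k 0.
have flow_star : cumulative_flow lambda nu m n.+1 (fun k => fun=> Sstar k).
  exact: fms_cumulative_flow zstar_invariant.
have Sstar_gt0 : 0 < Sstar n.+1.
  have [d d_gt0 dS] := flow_away flow_star.
  by near (+oo : set_system R) => t; apply: lt_le_trans d_gt0 _; near: t.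
have SstarE := stationary_flow_ratio nu_gt0 m_gt0 flow_star Sstar_gt0.
have ratio1 : ratio lambda nu m (Sstar n.+1) n.+1 = 1.
  apply: (mulfI (lt0r_neq0 Sstar_gt0)).
  by rewrite -SstarE// mulr1.
have S_cvg k : (k <= n.+1)%N -> partial_sum z k t @[t --> +oo] --> Sstar k.
  move=> kn; rewrite SstarE//.
  by apply: (flow_cvg lambda_gt0 nu_gt0 m_gt0 (fms_cumulative_flow z_fms)).
have z_cvg i : z t 0 i @[t --> +oo] --> zstar 0 i.
  have zE (y : R -> 'rV[R]_n.+1) t :
      y t 0 i = partial_sum y i.+1 t - partial_sum y i t.
    by rewrite /partial_sum big_ord_recr/= inord_val addrAC subrr add0r.
  under eq_fun do rewrite zE.
  rewrite (zE (fun=> zstar) 0).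
  by apply: cvgB; apply: S_cvg; rewrite // ltnW.
apply/cvgrPdist_le => e e_gt0.
have zi_near i : \forall t \near +oo, `|zstar 0 i - z t 0 i| <= e.
  by have /cvgrPdist_le := z_cvg i; apply.
near=> t.
have zt : forall i, `|zstar 0 i - z t 0 i| <= e.
  by near: t; exact: filter_forall zi_near.
rewrite -[leLHS]/(mx_norm _) mx_normrE; apply: bigmax_le; first exact: ltW.
by move=> [a i] _ /=; rewrite !mxE (ord1 a).
Unshelve. all: by end_near. Qed.
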